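(* Let $\widetilde A\in\mathbb{R}^{m\times n}$, $\widetilde A\neq 0$, and $\widetilde b\in\mathbb{R}^m$ be fixed, let $x_0\in\mathbb{R}^n$ be arbitrary, and let $\{x_k\}$ be the iterates of the randomized Kaczmarz algorithm applied to $\widetilde A x\approx\widetilde b$ and started at $x_0$. Then for any $A\in\mathbb{R}^{m\times n}$ and any $b\in\mathbb{R}^m$ such that the system $Ax=b$ is consistent, and for every $k\ge 0$, $$\mathbb{E}\,\| x_{k} -x_0^n- x_{\rm LS}^r\|^2 \le \left(1-\frac{1}{\widetilde R}\right)^{k}\| x_0^r-x_{\rm LS}^r \|^2+ \frac{\| E x_{\rm LS} - \epsilon \|^2}{\widetilde{\sigma}_{\min}^2},$$ where $x_{\rm LS}=A^\dagger b$, $E=\widetilde A-A$, $\epsilon=\widetilde b-b$, $\widetilde\sigma_{\min}$ is the smallest nonzero singular value of $\widetilde A$, and $\widetilde R=\|\widetilde A\|_F^2/\widetilde\sigma_{\min}^2$.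
   Context: Randomized Kaczmarz (RK) algorithm applied to $\widetilde A x\approx \widetilde b$ (a possibly inconsistent system): let $\widetilde a_i^\top$ denote the $i$-th row of $\widetilde A$. Starting from a deterministic $x_0\in\mathbb{R}^n$, for $k=0,1,2,\dots$, $$x_{k+1}=x_k-\frac{\widetilde a_{i(k)}^\top x_k-\widetilde b_{i(k)}}{\|\widetilde a_{i(k)}\|^2}\,\widetilde a_{i(k)},$$ where the indices $i(k)$ are drawn independently from $\{1,\dots,m\}$ with $\mathrm{Prob}(i(k)=i)=\|\widetilde a_i\|^2/\|\widetilde A\|_F^2$ (so zero rows are never selected). The expectation is over the random choice of indices. Here $\|\cdot\|$ is the Euclidean norm, $\|\cdot\|_F$ the Frobenius norm, and $M^\dagger$ the Moore–Penrose pseudoinverse. For $v\in\mathbb{R}^n$, $v^r$ denotes the orthogonal projection of $v$ onto $\mathrm{range}(\widetilde A^\top)$ and $v^n$ the orthogonal projection of $v$ onto $\mathrm{null}(\widetilde A)$. *)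

(* Defs.v *)
From HB Require Import structures.
From mathcomp Require Import all_boot all_order all_algebra.
From mathcomp Require Import all_classical all_reals all_analysis.
From mathcomp Require Import spectral complex.

Set Implicit Arguments.
Unset Strict Implicit.
Unset Printing Implicit Defensive.

Import Order.TTheory GRing.Theory Num.Theory.
Local Open Scope classical_set_scope.
Local Open Scope ring_scope.

Section Matrices.
Variable R : realType.

(* The library norm on matrices is the sup norm, hence these definitions. *)
Definition norm2 n (v : 'cV[R]_n) : R := Num.sqrt (\sum_i v i 0 ^+ 2).

Definition normF m n (M : 'M[R]_(m, n)) : R :=
  Num.sqrt (\sum_i \sum_j M i j ^+ 2).

(* The four Penrose equations. *)
Definition is_mppinv m n (M : 'M[R]_(m, n)) (X : 'M[R]_(n, m)) : Prop :=
  [/\ M *m X *m M = M, X *m M *m X = X,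
      (M *m X)^T = M *m X & (X *m M)^T = X *m M].

(* [xget] picks an element of the set; existence and uniqueness are
   [mppinvP] and [is_mppinv_uniq]. *)
Definition mppinv m n (M : 'M[R]_(m, n)) : 'M[R]_(n, m) :=
  xget 0 [set X | is_mppinv M X].

Definition col_space m n (M : 'M[R]_(m, n)) : set 'cV[R]_m :=
  [set v | exists y : 'cV[R]_n, v = M *m y].

Definition null_space m n (M : 'M[R]_(m, n)) : set 'cV[R]_n :=
  [set v | M *m v = 0].

Definition is_orthproj n (V : set 'cV[R]_n) (v p : 'cV[R]_n) : Prop :=
  V p /\ forall w, V w -> w^T *m (v - p) = 0.

(* Only meant for linear subspaces [V], where the projection exists uniquely
   ([orthproj_col_spaceP], [orthproj_null_spaceP], [is_orthproj_uniq]). *)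
Definition orthproj n (V : set 'cV[R]_n) (v : 'cV[R]_n) : 'cV[R]_n :=
  xget 0 [set p | is_orthproj V v p].

(* Square roots of the eigenvalues of M^T M; compared with the convention of
   min(m, n) singular values this can only differ by the value 0. *)
Definition singular_value m n (M : 'M[R]_(m, n)) : set R :=
  [set s | 0 <= s /\ eigenvalue (M^T *m M) (s ^+ 2)].

Definition is_sigma_min m n (M : 'M[R]_(m, n)) (s : R) : Prop :=
  [/\ singular_value M s, s != 0 &
      forall t, singular_value M t -> t != 0 -> s <= t].

(* Smallest nonzero singular value, for M != 0 (see [sigma_minP]). *)
Definition sigma_min m n (M : 'M[R]_(m, n)) : R :=
  xget 0 [set s | is_sigma_min M s].

(* A zero row gives a division by 0, hence the identity step; such rows have
   probability 0 in [rk_sampling]. *)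
Definition rk_step m n (A : 'M[R]_(m, n)) (b : 'cV[R]_m) (i : 'I_m)
    (x : 'cV[R]_n) : 'cV[R]_n :=
  let a := (row i A)^T in
  x - (((a^T *m x) 0 0 - b i 0) / norm2 a ^+ 2) *: a.

Fixpoint rk_iter m n (A : 'M[R]_(m, n)) (b : 'cV[R]_m) (x0 : 'cV[R]_n)
    (i : nat -> 'I_m) (k : nat) : 'cV[R]_n :=
  if k is k'.+1 then rk_step A b (i k') (rk_iter A b x0 i k') else x0.

End Matrices.

Section Sampling.
Context (R : realType) (d : measure_display) (T : measurableType d).
Variable P : probability T R.

(* Measurability with respect to the discrete sigma-algebra on 'I_m. *)
Definition index_measurable m (idx : nat -> T -> 'I_m) : Prop :=
  forall k (S : set 'I_m), measurable (idx k @^-1` S).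

(* Mutual independence: the product rule over every finite subfamily. *)
Definition index_independent m (idx : nat -> T -> 'I_m) : Prop :=
  forall (J : seq nat) (S : nat -> set 'I_m), uniq J ->
    P [set w | forall k, k \in J -> S k (idx k w)] =
    (\prod_(k <- J) P (idx k @^-1` (S k)))%E.

Definition rk_sampling m n (A : 'M[R]_(m, n)) (idx : nat -> T -> 'I_m) : Prop :=
  [/\ index_measurable idx, index_independent idx &
      forall k (i : 'I_m), P (idx k @^-1` [set i]) =
        (norm2 (row i A)^T ^+ 2 / normF A ^+ 2)%:E].

End Sampling.

Section WellDefined.
Variable R : realType.

Lemma trmx_mul_self_eq0 m n (M : 'M[R]_(m, n)) : M^T *m M = 0 -> M = 0.
Proof.
move=> MM0; apply/matrixP => i j; rewrite mxE.
have := congr1 (fun N : 'M[R]_n => N j j) MM0; rewrite !mxE => /eqP.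
rewrite psumr_eq0 => [|k _]; last by rewrite mxE -expr2 sqr_ge0.
by move=> /allP /(_ i (mem_index_enum i)); rewrite mxE -expr2 sqrf_eq0 => /eqP.
Qed.

Lemma is_mppinv_uniq m n (M : 'M[R]_(m, n)) (X Y : 'M[R]_(n, m)) :
  is_mppinv M X -> is_mppinv M Y -> X = Y.
Proof.
move=> [X1 X2 X3 X4] [Y1 Y2 Y3 Y4].
have MXY : M *m X = M *m Y.
  rewrite -{1}Y1 -mulmxA -X3 -{1}Y3 -trmx_mul.
  by rewrite mulmxA X1 Y3.
have XYM : X *m M = Y *m M.
  rewrite -{1}Y1 -!mulmxA (mulmxA X) -X4 -{1}Y4 -trmx_mul.
  by rewrite -!mulmxA (mulmxA M X) X1 Y4.
by rewrite -X2 XYM -mulmxA MXY mulmxA Y2.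
Qed.

Lemma gram_unitmx m n (M : 'M[R]_(m, n)) : row_free M -> M *m M^T \in unitmx.
Proof.
move=> fM; rewrite -row_free_unit -kermx_eq0; apply/eqP.
set K := kermx _.
have KM0 : K *m (M *m M^T) = 0 by exact: mulmx_ker.
have : (K *m M)^T = 0.
  by apply: trmx_mul_self_eq0; rewrite trmxK trmx_mul !mulmxA -(mulmxA K) KM0 mul0mx.
move/(congr1 trmx); rewrite trmxK trmx0 => KM.
by apply: (row_free_inj fM); rewrite KM mul0mx.
Qed.

Lemma mppinvP m n (M : 'M[R]_(m, n)) : is_mppinv M (mppinv M).
Proof.
rewrite /mppinv; apply: (@xgetPex _ 0 [set X | is_mppinv M X]).
have [r [C [F [MCF fC fF]]]] : exists r (C : 'M[R]_(m, r)) (F : 'M[R]_(r, n)),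
    [/\ M = C *m F, row_free C^T & row_free F].
  exists (\rank M), (col_base M), (row_base M); split.
  - by rewrite mulmx_base.
  - by rewrite -row_leq_rank mxrank_tr col_leq_rank col_base_full.
  - exact: row_base_free.
have uF : F *m F^T \in unitmx by rewrite gram_unitmx.
have uC : C^T *m C \in unitmx by rewrite -[X in _ *m X]trmxK gram_unitmx.
set U := invmx (F *m F^T); set V := invmx (C^T *m C).
exists (F^T *m U *m V *m C^T); rewrite /= /is_mppinv.
have FU : F *m F^T *m U = 1%:M by rewrite mulmxV.
have VC : V *m C^T *m C = 1%:M by rewrite -mulmxA mulVmx.
have MX : M *m (F^T *m U *m V *m C^T) = C *m V *m C^T.
  by rewrite MCF !mulmxA -2!(mulmxA C) FU mulmx1.
have XM : F^T *m U *m V *m C^T *m M = F^T *m U *m F.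
  by rewrite MCF !mulmxA -2!(mulmxA (_ *m U)) VC mulmx1.
have UT : U^T = U by rewrite trmx_inv trmx_mul trmxK.
have VT : V^T = V by rewrite trmx_inv trmx_mul trmxK.
rewrite MX XM; split.
- by rewrite MCF !mulmxA -2!(mulmxA C) VC mulmx1.
- by rewrite !mulmxA -2!(mulmxA (F^T *m U)) FU mulmx1.
- by rewrite !trmx_mul trmxK VT mulmxA.
- by rewrite !trmx_mul trmxK UT mulmxA.
Qed.

Lemma is_orthproj_uniq n (V : set 'cV[R]_n) (v p q : 'cV[R]_n) :
  (forall x y, V x -> V y -> V (x - y)) ->
  is_orthproj V v p -> is_orthproj V v q -> p = q.
Proof.
move=> Vsub [Vp hp] [Vq hq]; apply/eqP; rewrite -subr_eq0; apply/eqP.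
apply: trmx_mul_self_eq0; have Vpq := Vsub _ _ Vp Vq.
have -> : p - q = (v - q) - (v - p) by rewrite opprB [RHS]addrC addrA subrK.
rewrite [LHS]mulmxBr.
have -> : v - q - (v - p) = p - q by rewrite opprB addrC addrA subrK.
by rewrite hp // hq // subrr.
Qed.

Lemma orthproj_col_spaceP m n (M : 'M[R]_(m, n)) (v : 'cV[R]_m) :
  is_orthproj (col_space M) v (orthproj (col_space M) v).
Proof.
rewrite /orthproj; apply: (@xgetPex _ 0 [set p | is_orthproj _ v p]).
have [X1 _ X3 _] := mppinvP M.
exists (M *m (mppinv M *m v)); split; first by exists (mppinv M *m v).
move=> w [y ->]; rewrite mulmxA -X3 mulmxBr !trmx_mul !mulmxA.
by rewrite -{1}X1 !trmx_mul !mulmxA subrr.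
Qed.

Lemma orthproj_null_spaceP m n (M : 'M[R]_(m, n)) (v : 'cV[R]_n) :
  is_orthproj (null_space M) v (orthproj (null_space M) v).
Proof.
rewrite /orthproj; apply: (@xgetPex _ 0 [set p | is_orthproj _ v p]).
have [X1 _ _ X4] := mppinvP M.
exists (v - mppinv M *m M *m v); split.
  by rewrite /null_space /= mulmxBr !mulmxA X1 subrr.
move=> w /= Mw; rewrite opprB addrC subrK -X4 mulmxA -trmx_mul.
by rewrite -mulmxA Mw mulmx0 trmx0 mul0mx.
Qed.

Lemma sym_eigenvalues n (G : 'M[R]_n) : G^T = G ->
  exists D : 'I_n -> R, (forall r, eigenvalue G r <-> exists j, r = D j) /\
                        (G != 0 -> exists j, D j != 0).
Proof.
move=> GT; pose toC := real_complex R; pose GC := map_mx toC G.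
have GCreal : GC \is a mxOver Num.real.
  by apply/mxOverP => i j; rewrite mxE; apply/complex_realP; exists (G i j).
have GCsym : GC \is hermitianmx n false idfun.
  apply/is_hermitianmxP; rewrite expr0 scale1r; apply/matrixP => i j.
  by rewrite !mxE -[in LHS]GT mxE.
have /orthomx_spectralP := symmetric_normalmx GCsym GCreal.
set P := spectralmx GC; set L := spectral_diag GC => GCE.
have Pu : P \in unitmx := spectral_unit GC.
have Lreal : L \is a mxOver Num.real.
  exact/hermitian_spectral_diag_real/realsym_hermsym.
have LE j : L 0 j = toC (complex.Re (L 0 j)).
  by rewrite -[RHS]/((complex.Re (L 0 j))%:C)%C RRe_real //; apply/mxOverP.
have LP : P *m GC = diag_mx L *m P by rewrite GCE !mulmxA mulmxV // mul1mx.
exists (fun j => complex.Re (L 0 j)); split=> [r|G0].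
  split=> [/eigenvalueP[v vG v0]|[j ->]].
    pose u := map_mx toC v *m invmx P.
    have uP : u *m P = map_mx toC v by rewrite mulmxKV.
    have uL : u *m diag_mx L = toC r *: u.
      apply: (can_inj (mulmxK Pu)); rewrite -mulmxA -LP mulmxA uP.
      by rewrite -map_mxM vG map_mxZ -scalemxAl uP.
    have /rV0Pn[j uj0] : u != 0.
      apply: contra v0 => /eqP u0; move: uP.
      by rewrite u0 mul0mx => /esym/eqP; rewrite map_mx_eq0.
    exists j; have /(mulIf uj0) : toC r * u 0 j = L 0 j * u 0 j.
      by move/rowP: uL => /(_ j); rewrite mul_mx_diag [LHS]mxE [RHS]mxE mulrC.
    by rewrite LE => /complexI.
  have : eigenvalue GC (L 0 j); first apply/eigenvalueP; first exists (row j P).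
    by rewrite -row_mul LP row_mul row_diag_mx -scalemxAl -rowE.
    apply/eqP => rP0; have : delta_mx 0 j *m P = 0 :> 'rV_n by rewrite -rowE.
    move/(congr1 (mulmx^~ (invmx P))); rewrite mulmxK // mul0mx.
    by move=> /rowP /(_ j); rewrite !mxE !eqxx => /eqP; rewrite oner_eq0.
  by rewrite LE !eigenvalue_root_char -map_char_poly fmorph_root.
apply/existsP; apply: contraNT G0 => /existsPn D0.
have L0 : L = 0.
  by apply/rowP => j; rewrite LE; move/(_ j): D0; rewrite negbK => /eqP ->; rewrite !mxE.
move: GCE; rewrite L0 linear0 mulmx0 mul0mx => /eqP.
by rewrite map_mx_eq0.
Qed.

Lemma gram_eigenvalue_ge0 m n (M : 'M[R]_(m, n)) r :
  eigenvalue (M^T *m M) r -> 0 <= r.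
Proof.
have sqn k (u : 'rV[R]_k) : (u *m u^T) 0 0 = \sum_j u 0 j ^+ 2.
  by rewrite mxE; apply: eq_bigr => j _; rewrite mxE expr2.
move=> /eigenvalueP[v vG /rV0Pn[j vj0]].
have : (v *m M^T *m (v *m M^T)^T) 0 0 = r * (v *m v^T) 0 0.
  by rewrite trmx_mul trmxK !mulmxA -(mulmxA v) vG -scalemxAl mxE.
rewrite !sqn => e.
have v_gt0 : 0 < \sum_j v 0 j ^+ 2.
  rewrite (bigD1 j) //= ltr_pwDl ?exprn_even_gt0 //.
  by apply: sumr_ge0 => i _; apply: sqr_ge0.
by rewrite -(pmulr_lge0 _ v_gt0) -e; apply: sumr_ge0 => i _; apply: sqr_ge0.
Qed.

Lemma sigma_minP m n (M : 'M[R]_(m, n)) :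
  M != 0 -> is_sigma_min M (sigma_min M).
Proof.
move=> M0; rewrite /sigma_min; apply: (@xgetPex _ 0 [set s | is_sigma_min M s]).
have GT : (M^T *m M)^T = M^T *m M by rewrite trmx_mul trmxK.
have [D [eigD exD]] := sym_eigenvalues GT.
have [|j0 Dj0] := exD; first by apply: contra M0 => /eqP /trmx_mul_self_eq0 ->.
have D_ge0 j : 0 <= D j.
  by apply: (@gram_eigenvalue_ge0 _ _ M); apply/eigD; exists j.
case: (@arg_minP _ _ _ j0 (fun j => D j != 0) D Dj0) => j Dj Dmin.
exists (Num.sqrt (D j)); split.
- by split; rewrite ?sqrtr_ge0 // sqr_sqrtr //; apply/eigD; exists j.
- by rewrite sqrtr_eq0 -ltNge lt0r Dj D_ge0.
move=> t [t0 /eigD[i tD]] tn0.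
rewrite -(ger0_norm t0) -sqrtr_sqr ler_sqrt ?sqr_ge0 //.
by rewrite tD Dmin // -tD sqrf_eq0.
Qed.

End WellDefined.

(* Main.v *)
Require Import Defs.
From HB Require Import structures.
From mathcomp Require Import all_boot all_order all_algebra.
From mathcomp Require Import all_classical all_reals all_analysis.
From mathcomp Require Import measurable_realfun spectral complex ring lra.

Set Implicit Arguments.
Unset Strict Implicit.
Unset Printing Implicit Defensive.

Import Order.TTheory GRing.Theory Num.Theory.
Local Open Scope ring_scope.

(** Put z = x0^n + xLS^r and e_k = x_k - z. The null-space part of x0 is never
    touched by the iteration, because every update is a multiple of a row of
    the matrix; so e_k stays in the row space. Moreover z solves the perturbed
    system up to the residual bt - At z = bt - At xLS = eps - E xLS, where
    consistency enters through A xLS = b.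

    One step with the row a of index i and residual entry r obeys the identity
      |e'|^2 = |e|^2 - ((a . e)^2 - r^2) / |a|^2,
    and the sampling weight |a|^2 / |At|_F^2 cancels the denominator
    ([row_prob_rk_step]). Averaging over i gives |e|^2 - |At e|^2 / |At|_F^2
    plus a noise term at most |bt - At z|^2 / |At|_F^2 (zero rows make it an
    inequality), and |At e| >= sigma_min |e| on the row space
    ([sigma_min_le_norm]) turns this into a contraction by the factor
    1 - sigma_min^2 / |At|_F^2 up to noise ([rk_step_contract]).

    The index drawn at time k is independent of the k earlier ones, so the
    one-step bound passes to expectations ([expectation_next_le]). The claimed
    error floor |E xLS - eps|^2 / sigma_min^2 is exactly the fixed point of the
    affine recursion obtained, hence a plain induction on k closes
    ([rk_expected_sqr_error]); it multiplies the previous bound by the factor,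
    which therefore must be nonnegative ([rk_rate_ge0]). *)

(** * Euclidean geometry and the smallest singular value *)

Section Euclidean.
Variable R : realType.

Lemma norm2_sqrE n (v : 'cV[R]_n) : norm2 v ^+ 2 = \sum_i v i 0 ^+ 2.
Proof. by rewrite sqr_sqrtr // sumr_ge0 // => i _; rewrite sqr_ge0. Qed.

Lemma norm2_sqr_dot n (v : 'cV[R]_n) : norm2 v ^+ 2 = (v^T *m v) 0 0.
Proof. by rewrite norm2_sqrE mxE; apply: eq_bigr => i _; rewrite mxE expr2. Qed.

Lemma norm2_eq0 n (v : 'cV[R]_n) : norm2 v = 0 -> v = 0.
Proof.
move=> v0; apply: trmx_mul_self_eq0; apply/matrixP => i j.
by rewrite !ord1 -norm2_sqr_dot v0 expr0n mxE.
Qed.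

Lemma norm2N n (v : 'cV[R]_n) : norm2 (- v) = norm2 v.
Proof. by congr Num.sqrt; apply: eq_bigr => i _; rewrite mxE sqrrN. Qed.

Lemma normF_sqrE m n (M : 'M[R]_(m, n)) :
  normF M ^+ 2 = \sum_i norm2 (row i M)^T ^+ 2.
Proof.
rewrite sqr_sqrtr; last first.
  by rewrite sumr_ge0 // => i _; rewrite sumr_ge0 // => j _; rewrite sqr_ge0.
apply: eq_bigr => i _; rewrite norm2_sqrE.
by apply: eq_bigr => j _; rewrite !mxE.
Qed.

Lemma normF_gt0 m n (M : 'M[R]_(m, n)) : M != 0 -> 0 < normF M ^+ 2.
Proof.
move=> M0; rewrite lt0r sqr_ge0 andbT; apply: contra M0.
rewrite normF_sqrE psumr_eq0 => [/allP r0|i _]; last exact: sqr_ge0.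
apply/eqP/row_matrixP => i; have := r0 i (mem_index_enum i).
by rewrite sqrf_eq0 => /eqP/norm2_eq0/(congr1 trmx); rewrite trmxK trmx0 row0.
Qed.

(** The form in which the spectral theorem is used: c is the spectral measure
    of y, so that quadratic forms in powers of G become weighted power sums of
    eigenvalues and inequalities between them can be checked termwise. Only
    the proof passes to complex matrices: there G = U^* L U with U unitary, and
    c j is the squared modulus of the j-th entry of U y. *)
Lemma spectral_moments n (G : 'M[R]_n) : G^T = G ->
  exists D : 'I_n -> R, (forall j, eigenvalue G (D j)) /\
    forall y : 'cV[R]_n, exists c : 'I_n -> R, (forall j, 0 <= c j) /\
      forall p, (y^T *m G ^+ p *m y) 0 0 = \sum_j D j ^+ p * c j.
Proof.
move=> GT; pose toC := real_complex R; pose GC := map_mx toC G.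
have toCM : {morph toC : x y / x * y} := rmorphM toC.
have GCreal : GC \is a mxOver Num.real.
  by apply/mxOverP => i j; rewrite mxE; apply/complex_realP; exists (G i j).
have GCsym : GC \is hermitianmx n false idfun.
  apply/is_hermitianmxP; rewrite expr0 scale1r; apply/matrixP => i j.
  by rewrite !mxE -[in LHS]GT mxE.
have /orthomx_spectralP := symmetric_normalmx GCsym GCreal.
set U := spectralmx GC; set L := spectral_diag GC => GCE.
have Uu : U \in unitmx := spectral_unit GC.
have UV : invmx U = map_mx Num.conj U^T := invmx_unitary (spectral_unitarymx GC).
have Lreal : L \is a mxOver Num.real.
  exact/hermitian_spectral_diag_real/realsym_hermsym.
pose D j := complex.Re (L 0 j).
have LE j : L 0 j = toC (D j).
  by rewrite -[RHS]/((complex.Re (L 0 j))%:C)%C RRe_real //; apply/mxOverP.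
have LU : U *m GC = diag_mx L *m U by rewrite GCE !mulmxA mulmxV // mul1mx.
have LUp p : U *m GC ^+ p = diag_mx (\row_j toC (D j ^+ p)) *m U.
  elim: p => [|p IH].
    rewrite expr0 [U *m _]mulmx1 -[LHS]mul1mx; congr (_ *m _).
    by apply/matrixP => i j; rewrite !mxE expr0.
  rewrite exprSr [U *m _]mulmxA IH -mulmxA LU mulmxA; congr (_ *m _).
  apply/matrixP => i j; rewrite mul_diag_mx !mxE LE exprSr toCM.
  by rewrite mulrnAr.
exists D; split=> [j|y].
  have : eigenvalue GC (L 0 j); first apply/eigenvalueP; first exists (row j U).
    by rewrite -row_mul LU row_mul row_diag_mx -scalemxAl -rowE.
    apply/eqP => rU0; have : delta_mx 0 j *m U = 0 :> 'rV_n by rewrite -rowE.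
    move/(congr1 (mulmx^~ (invmx U))); rewrite mulmxK // mul0mx.
    by move=> /rowP /(_ j); rewrite !mxE !eqxx => /eqP; rewrite oner_eq0.
  by rewrite LE !eigenvalue_root_char -map_char_poly fmorph_root.
pose u := U *m map_mx toC y.
pose c j := complex.Re (`|u j 0| ^+ 2).
have cE j : toC (c j) = `|u j 0| ^+ 2.
  rewrite -[LHS]/((complex.Re (`|u j 0| ^+ 2))%:C)%C RRe_real //.
exists c; split=> [j|p].
  by rewrite -(ler0c (c j)) -[((c j)%:C)%C]/(toC (c j)) cE exprn_ge0.
have toCS (F : 'I_n -> R) : toC (\sum_j F j) = \sum_j toC (F j).
  exact: (rmorph_sum toC).
apply: (@complexI R); rewrite -[LHS]/(toC _) -[RHS]/(toC _).
have -> : toC ((y^T *m G ^+ p *m y) 0 0) =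
    (map_mx Num.conj u^T *m (U *m GC ^+ p *m map_mx toC y)) 0 0.
  have GCp : GC ^+ p = map_mx toC (G ^+ p).
    elim: p {LUp} => [|p IH]; first by rewrite !expr0 map_mx1.
    by rewrite !exprS map_mxM IH.
  have ut : map_mx Num.conj u^T = (map_mx toC y)^T *m invmx U.
    rewrite UV trmx_mul map_mxM; congr (_ *m _).
    apply/matrixP => i j; rewrite !mxE; apply: CrealP.
    by apply/complex_realP; exists (y j i).
  rewrite ut !mulmxA mulmxKV // GCp map_trmx -!map_mxM.
  by rewrite [RHS]mxE.
rewrite LUp -mulmxA -/u mxE toCS; apply: eq_bigr => j _.
rewrite mul_diag_mx !mxE toCM cE normCK mulrCA; congr (_ * _).
by rewrite mulrC /u [(U *m _) j 0]mxE.
Qed.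

Lemma sigma_min_gt0 m n (M : 'M[R]_(m, n)) : M != 0 -> 0 < sigma_min M ^+ 2.
Proof.
by move=> /sigma_minP[_ s0 _]; rewrite lt0r sqrf_eq0 s0 sqr_ge0.
Qed.

(** The row space of M is the range of G = M^T M, so v = G y; then |v|^2 and
    |M v|^2 are the second and third spectral moments of y. Null eigenvalues
    drop out of both, and the others are at least sigma_min^2. *)
Lemma sigma_min_le_norm m n (M : 'M[R]_(m, n)) (v : 'cV[R]_n) :
  M != 0 -> col_space M^T v ->
  sigma_min M ^+ 2 * norm2 v ^+ 2 <= norm2 (M *m v) ^+ 2.
Proof.
move=> M0 [z vz]; have [[s0 _] _ smin] := sigma_minP M0.
pose G := M^T *m M; have GT : G^T = G by rewrite trmx_mul trmxK.
(* M^T = (M X M)^T = M^T M X, with X the pseudoinverse. *)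
have [y vy] : exists y, v = G *m y.
  have [X1 _ X3 _] := mppinvP M; exists (mppinv M *m z).
  by rewrite vz -{1}X1 trmx_mul X3 !mulmxA.
have [D [eigD /(_ y)[c [c0 momE]]]] := spectral_moments GT.
have -> : norm2 v ^+ 2 = \sum_j D j ^+ 2 * c j.
  by rewrite -momE norm2_sqr_dot vy trmx_mul GT expr2 !mulmxA.
have -> : norm2 (M *m v) ^+ 2 = \sum_j D j ^+ 3 * c j.
  rewrite -momE norm2_sqr_dot vy 2!trmx_mul GT.
  have -> : G ^+ 3 = G *m (G *m G) by rewrite !exprS expr0 mulr1.
  by rewrite -!mulmxA (mulmxA M^T).
rewrite mulr_sumr ler_sum // => j _; rewrite mulrA ler_wpM2r // [leRHS]exprS.
have D0 := gram_eigenvalue_ge0 (eigD j).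
have [->|Dj0] := eqVneq (D j) 0; first by rewrite expr0n mul0r mulr0.
rewrite ler_wpM2r ?sqr_ge0 // -[leRHS]sqr_sqrtr //.
rewrite ler_pXn2r ?nnegrE ?sqrtr_ge0 //; apply: smin; last first.
  by rewrite sqrtr_eq0 -ltNge lt0r Dj0.
by split; rewrite ?sqrtr_ge0 // sqr_sqrtr.
Qed.

(** The null space and the row space are orthogonal complements: what is left
    of v after removing its null part lies in the row space, because its
    component off the row space is in the null space and orthogonal to itself. *)
Lemma sub_orthproj_null m n (M : 'M[R]_(m, n)) (v : 'cV[R]_n) :
  v - orthproj (null_space M) v = orthproj (col_space M^T) v.
Proof.
have [Nv Nw] := orthproj_null_spaceP M v.
apply: (@is_orthproj_uniq _ _ (col_space M^T) v) => [x y [s ->] [t ->]||].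
- by exists (s - t); rewrite mulmxBr.
- split=> [|w [y ->]].
    have [X1 _ _ X4] := mppinvP M; set e := v - _.
    have /eqP : norm2 (e - mppinv M *m M *m e) ^+ 2 = 0.
      set f := e - _; have Mf : M *m f = 0 by rewrite mulmxBr !mulmxA X1 subrr.
      rewrite norm2_sqr_dot mulmxBr (Nw f Mf) -X4 mulmxA -trmx_mul.
      by rewrite -mulmxA Mf mulmx0 trmx0 mul0mx subrr mxE.
    rewrite sqrf_eq0 => /eqP/norm2_eq0/eqP; rewrite subr_eq0 => /eqP ->.
    by rewrite -X4 trmx_mul -mulmxA; exists ((mppinv M)^T *m e).
  by rewrite opprB addrC subrK trmx_mul trmxK -mulmxA Nv mulmx0.
- exact: orthproj_col_spaceP.
Qed.

Lemma mulmx_orthproj_row m n (M : 'M[R]_(m, n)) (v : 'cV[R]_n) :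
  M *m orthproj (col_space M^T) v = M *m v.
Proof.
have [Nv _] := orthproj_null_spaceP M v.
by rewrite -sub_orthproj_null mulmxBr Nv subr0.
Qed.

End Euclidean.

(** * One step of the iteration *)

Section Step.
Variables (R : realType) (m n : nat) (A : 'M[R]_(m, n)) (b : 'cV[R]_m).
Implicit Types (x z : 'cV[R]_n) (i : 'I_m).

Definition row_prob i : R := norm2 (row i A)^T ^+ 2 / normF A ^+ 2.

Lemma row_prob_ge0 i : 0 <= row_prob i.
Proof. by rewrite divr_ge0 // sqr_ge0. Qed.

Lemma row_prob_sum : A != 0 -> \sum_i row_prob i = 1.
Proof.
move=> A0; rewrite -mulr_suml -normF_sqrE divff //.
by rewrite gt_eqF // normF_gt0.
Qed.

Lemma rk_step_sub_col_space z x i :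
  col_space A^T (x - z) -> col_space A^T (rk_step A b i x - z).
Proof.
move=> [y xz]; rewrite /rk_step; set t := _ / _.
exists (y - t *: delta_mx i 0).
by rewrite mulmxBr -scalemxAr -colE -xz tr_row addrAC.
Qed.

(** The update projects onto the hyperplane of equation i, so this is
    Pythagoras, up to the defect of z in that equation. It is an equality
    except for a zero row, where the weight vanishes while the defect of z
    may not. *)
Lemma row_prob_rk_step z x i :
  row_prob i * norm2 (rk_step A b i x - z) ^+ 2 <=
  row_prob i * norm2 (x - z) ^+ 2 +
  ((b - A *m z) i 0 ^+ 2 - (A *m (x - z)) i 0 ^+ 2) / normF A ^+ 2.
Proof.
rewrite /row_prob; set N := norm2 (row i A)^T ^+ 2; set F := normF A ^+ 2.
have F0 : 0 <= F by rewrite sqr_ge0.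
set e := x - z; set r := (b - A *m z) i 0; set g := (A *m e) i 0.
have gE : (((row i A)^T)^T *m e) 0 0 = g by rewrite trmxK -row_mul mxE.
have [N0|N0] := eqVneq N 0.
  have /norm2_eq0 a0 : norm2 (row i A)^T = 0 by apply/eqP; rewrite -sqrf_eq0 -/N N0.
  rewrite N0 !mul0r add0r -gE a0 trmx0 mul0mx !mxE expr0n subr0.
  by rewrite divr_ge0 // sqr_ge0.
have resE : (((row i A)^T)^T *m x) 0 0 - b i 0 = g - r.
  by rewrite -gE /e /r mulmxBr !trmxK -!row_mul !mxE; ring.
rewrite /rk_step resE -/N; set t := (g - r) / N.
have -> : x - t *: (row i A)^T - z = e - t *: (row i A)^T by rewrite addrAC.
have -> : norm2 (e - t *: (row i A)^T) ^+ 2 = norm2 e ^+ 2 - 2 * t * g + t ^+ 2 * N.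
  rewrite /N !norm2_sqrE -gE mxE !mulr_sumr -sumrB -big_split /=.
  by apply: eq_bigr => j _; rewrite !mxE; ring.
rewrite le_eqVlt; apply/orP; left; apply/eqP.
have tN : t * N = g - r by rewrite divfK.
rewrite (_ : _ - _ + _ = norm2 e ^+ 2 - t * (g + r)); last by rewrite expr2; ring: tN.
rewrite mulrBr mulrAC [X in _ - X](_ : _ = (t * N) * (g + r) / F); last by ring.
by rewrite tN; ring.
Qed.

Definition rk_rate : R := 1 - sigma_min A ^+ 2 / normF A ^+ 2.

Lemma rk_step_contract z x : A != 0 -> col_space A^T (x - z) ->
  \sum_i row_prob i * norm2 (rk_step A b i x - z) ^+ 2 <=
  rk_rate * norm2 (x - z) ^+ 2 + norm2 (b - A *m z) ^+ 2 / normF A ^+ 2.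
Proof.
move=> A0 xz; apply: le_trans (ler_sum _ (fun i _ => row_prob_rk_step z x i)) _.
rewrite big_split /= -mulr_suml row_prob_sum // -mulr_suml sumrB -!norm2_sqrE.
have F0 := normF_gt0 A0; have := sigma_min_le_norm A0 xz.
rewrite -(ler_pM2r (x := (normF A ^+ 2)^-1)) ?invr_gt0 // /rk_rate.
by rewrite mulrBl => h; lra.
Qed.

End Step.

(** Run one step on the homogeneous system, with reference point 0 and starting
    from a nonzero row: the contraction bound has no noise term, and its left
    side is nonnegative. *)
Lemma rk_rate_ge0 (R : realType) m n (A : 'M[R]_(m, n)) : A != 0 -> 0 <= rk_rate A.
Proof.
move=> A0; have [i ri] : exists i, (row i A)^T != 0.
  apply/existsP; apply: contraNT A0 => /existsPn r0.
  apply/eqP/row_matrixP => i; rewrite row0 -[LHS]trmxK.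
  by have /negPn/eqP -> := r0 i; rewrite trmx0.
set e := (row i A)^T in ri *.
have e0 : 0 < norm2 e ^+ 2.
  by rewrite lt0r sqr_ge0 sqrf_eq0 andbT; apply: contra ri => /eqP/norm2_eq0 ->.
have ce : col_space A^T (e - 0) by rewrite subr0 /e tr_row colE; eexists.
have := rk_step_contract 0 A0 ce; rewrite mulmx0 !subr0.
rewrite [X in _ + X](_ : _ = 0) ?addr0 => [h|]; last first.
  by rewrite norm2_sqrE big1 ?mul0r // => j _; rewrite mxE expr0n.
rewrite -(pmulr_lge0 _ e0); apply: le_trans h; apply: sumr_ge0 => j _.
by rewrite mulr_ge0 ?row_prob_ge0 ?sqr_ge0.
Qed.

(** * Expectations over the sampled indices *)

Section Sampling.
Context (R : realType) (d : measure_display) (T : measurableType d).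
Variable P : probability T R.

(** Everything random at a fixed time takes finitely many values, which turns
    expectations into finite sums. *)
Lemma expectation_finType (F : finType) (Y : T -> F) (h : F -> R) :
  (forall s, measurable (Y @^-1` [set s])%classic) -> (forall s, 0 <= h s) ->
  ('E_P[fun w => h (Y w)])%E = (\sum_s h s * fine (P (Y @^-1` [set s])%classic))%:E.
Proof.
move=> mY h0; rewrite unlock.
transitivity (\int[P]_w (\sum_s (h s)%:E * (\1_(Y @^-1` [set s])%classic w)%:E))%E.
  apply: eq_integral => w _; rewrite (bigD1 (Y w)) //= indicE mem_set // mule1.
  rewrite big1 ?adde0 // => s sY; rewrite indicE memNset ?mule0 //= => /esym/eqP.
  by rewrite (negPf sY).
have mi s : measurable_fun [set: T] (EFin \o (\1_(Y @^-1` [set s]) : T -> R))%classic.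
  by apply/measurable_EFinP; exact: measurable_indic.
rewrite ge0_integral_sum //; first last.
- by move=> s w _; rewrite -EFinM lee_fin mulr_ge0 // indicE.
- by move=> s; apply: measurable_funeM; exact: mi.
rewrite -sumEFin; apply: eq_bigr => s _.
rewrite (ge0_integralZl_EFin P measurableT _ (mi s)) //; last first.
  by move=> w _; rewrite lee_fin indicE.
rewrite integral_indic // setIT EFinM fineK // fin_num_measure //; exact: mY.
Qed.

Variables (m : nat) (idx : nat -> T -> 'I_m).

Definition history k w : k.-tuple 'I_m :=
  map_tuple (fun j => idx j w) (iota_tuple k 0).

(** Cylinder form of a history event, as required by mutual independence. The
    default value of nth is the tested index itself; times below k never reach
    it, and it spares an inhabitant of 'I_m. *)
Lemma history_preimage k (s : k.-tuple 'I_m) :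
  (history k @^-1` [set s] =
   [set w | forall j, j \in iota 0 k -> [set i | nth i s j = i] (idx j w)])%classic.
Proof.
apply/seteqP; split=> w /=.
  move=> <- j; rewrite mem_iota add0n /= => jk.
  by rewrite (nth_map 0) ?size_iota // nth_iota.
move=> sw; apply/eq_from_tnth => j.
have jk : (nat_of_ord j) \in iota 0 k by rewrite mem_iota add0n /=.
rewrite !(tnth_nth (idx j w)) /= (nth_map 0) ?size_iota // nth_iota //.
by rewrite add0n (sw _ jk).
Qed.

Hypotheses (idx_meas : index_measurable idx) (idx_indep : index_independent P idx).

Lemma measurable_history k s : measurable (history k @^-1` [set s])%classic.
Proof.
rewrite history_preimage.
rewrite (_ : mkset _ =
  \bigcap_(j in [set` iota 0 k]) (idx j @^-1` [set i | nth i s j = i]))%classic.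
  by apply: bigcap_measurableType => j _; exact: idx_meas.
by apply/seteqP; split=> w.
Qed.

Lemma history_next_indep k (s : k.-tuple 'I_m) (i : 'I_m) :
  P ((fun w => (history k w, idx k w)) @^-1` [set (s, i)])%classic =
  (P (history k @^-1` [set s])%classic * P (idx k @^-1` [set i])%classic)%E.
Proof.
pose S j := if j == k then [set i]%classic else [set i' | nth i' s j = i']%classic.
have Slt j : j \in iota 0 k -> S j = [set i' | nth i' s j = i']%classic.
  by rewrite mem_iota add0n /S => /= jk; rewrite ltn_eqF.
have Sk : S k = [set i]%classic by rewrite /S eqxx.
have -> : ((fun w => (history k w, idx k w)) @^-1` [set (s, i)] =
    [set w | forall j, j \in iota 0 k.+1 -> S j (idx j w)])%classic.
  transitivity ((history k @^-1` [set s]) `&` (idx k @^-1` [set i]))%classic.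
    by apply/seteqP; split=> w /= [-> ->].
  rewrite history_preimage -addn1 iotaD add0n; apply/seteqP; split=> w /=.
    move=> [sw iw] j; rewrite mem_cat inE => /orP[jk|/eqP ->].
      by rewrite Slt //; exact: sw.
    by rewrite Sk.
  move=> sw; split=> [j jk|].
    by have := sw j; rewrite mem_cat jk Slt //; apply.
  by have := sw k; rewrite mem_cat inE eqxx orbT Sk; apply.
rewrite (idx_indep S (iota_uniq 0 k.+1)) -addn1 iotaD add0n big_cat big_seq1 Sk.
congr (_ * _)%E; rewrite history_preimage (idx_indep
  (fun j => [set i' | nth i' s j = i']%classic) (iota_uniq 0 k)).
by apply: eq_big_seq => j jk; rewrite Slt.
Qed.

Lemma measurable_history_next k u :
  measurable ((fun w => (history k w, idx k w)) @^-1` [set u])%classic.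
Proof.
case: u => s i.
rewrite (_ : _ @^-1` _ =
  (history k @^-1` [set s]) `&` (idx k @^-1` [set i]))%classic.
  by apply: measurableI; [exact: measurable_history|exact: idx_meas].
by apply/seteqP; split=> w /= [-> ->].
Qed.

(** The tower property in elementary form: the conditional expectation of g
    given a history s is the sum over i of p i * g (s, i), by independence, so
    a bound for each s can be averaged over s. *)
Lemma expectation_next_le k (f : k.-tuple 'I_m -> R) (g : k.-tuple 'I_m * 'I_m -> R)
    (p : 'I_m -> R) (rho c : R) :
  (forall s, 0 <= f s) -> (forall u, 0 <= g u) ->
  (forall i, P (idx k @^-1` [set i])%classic = (p i)%:E) ->
  (forall s, \sum_i p i * g (s, i) <= rho * f s + c) ->
  ('E_P[fun w => g (history k w, idx k w)] <=
   rho%:E * 'E_P[fun w => f (history k w)] + c%:E)%E.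
Proof.
move=> f0 g0 pE step.
rewrite (expectation_finType (@measurable_history_next k) g0).
rewrite (expectation_finType (@measurable_history k) f0).
pose q s := fine (P (history k @^-1` [set s])%classic).
have q0 s : 0 <= q s by rewrite fine_ge0.
have q1 : \sum_s q s = 1.
  have := expectation_finType (@measurable_history k) (h := fun=> 1) (fun=> ler01).
  rewrite (expectation_cst P 1) => -[e]; rewrite [RHS]e.
  by apply: eq_bigr => s _; rewrite mul1r.
rewrite -EFinM -EFinD lee_fin.
rewrite -[c]mulr1 -q1 !mulr_sumr -big_split /=.
rewrite (eq_bigr (fun u => q u.1 * (p u.2 * g (u.1, u.2)))); last first.
  case=> s i _ /=; rewrite history_next_indep pE fineM ?fin_num_measure //=.
    by rewrite mulrC mulrA.
  exact: measurable_history.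
rewrite -(pair_bigA _ (fun s i => q s * (p i * g (s, i)))) /=.
apply: ler_sum => s _; rewrite -mulr_sumr.
apply: le_trans (ler_wpM2l (q0 s) (step s)) _.
by rewrite mulrDr -/(q s) le_eqVlt; apply/orP; left; apply/eqP; ring.
Qed.

End Sampling.

(** * Convergence of the iteration *)

Lemma rk_iter_foldl (R : realType) m n (A : 'M[R]_(m, n)) b x0 (i : nat -> 'I_m) k :
  rk_iter A b x0 i k = foldl (fun x j => rk_step A b j x) x0 (map i (iota 0 k)).
Proof.
elim: k => // k IH; rewrite -(addn1 k) iotaD map_cat foldl_cat -IH /= add0n addn1.
by [].
Qed.

(** Any reference point that differs from x0 by a row-space vector will do; the
    noise floor is governed by its residual. *)
Lemma rk_expected_sqr_error (R : realType) m n (A : 'M[R]_(m, n))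
    (b : 'cV[R]_m) (x0 z : 'cV[R]_n) (d : measure_display)
    (T : measurableType d) (P : probability T R) (idx : nat -> T -> 'I_m) k :
  A != 0 -> rk_sampling P A idx -> col_space A^T (x0 - z) ->
  ('E_P[fun w => (norm2 (rk_iter A b x0 (idx^~ w) k - z) ^+ 2)%R] <=
   (rk_rate A ^+ k * norm2 (x0 - z) ^+ 2
    + norm2 (b - A *m z) ^+ 2 / sigma_min A ^+ 2)%R%:E)%E.
Proof.
move=> A0 [mI iI pI] e0.
pose iter (s : seq 'I_m) := foldl (fun x j => rk_step A b j x) x0 s.
have iter_col s : col_space A^T (iter s - z).
  elim/last_ind: s => // s i IH.
  by rewrite /iter foldl_rcons; exact: rk_step_sub_col_space.
set c := norm2 (b - A *m z) ^+ 2.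
have F0 := normF_gt0 A0; have s0 := sigma_min_gt0 A0.
have err j : (fun w => norm2 (rk_iter A b x0 (idx^~ w) j - z) ^+ 2)
    = (fun w => norm2 (iter (history idx j w) - z) ^+ 2).
  by apply/funext => w; rewrite rk_iter_foldl.
elim: k => [|k IH].
  rewrite (expectation_cst P (norm2 (x0 - z) ^+ 2)) lee_fin expr0 mul1r lerDl.
  by rewrite divr_ge0 // sqr_ge0.
pose g (u : k.-tuple 'I_m * 'I_m) :=
  norm2 (rk_step A b u.2 (iter u.1) - z) ^+ 2.
have -> : (fun w => norm2 (rk_iter A b x0 (idx^~ w) k.+1 - z) ^+ 2) =
    (fun w => g (history idx k w, idx k w)).
  by apply/funext => w; rewrite /= rk_iter_foldl.
have step (s : k.-tuple 'I_m) : \sum_i row_prob A i * g (s, i) <=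
    rk_rate A * norm2 (iter s - z) ^+ 2 + c / normF A ^+ 2.
  exact: rk_step_contract.
apply: le_trans (expectation_next_le mI iI _ _ (pI k) step) _.
- by move=> s; rewrite sqr_ge0.
- by move=> u; rewrite sqr_ge0.
rewrite -err.
apply: le_trans (leeD2r _ (lee_wpmul2l _ IH)) _.
  by rewrite lee_fin rk_rate_ge0.
rewrite -EFinM -EFinD lee_fin (exprS _ k) /rk_rate le_eqVlt; apply/orP; left; apply/eqP.
(* With q the k-th power of the factor, this is
   (1 - s/F) (q e + c/s) + c/F = (1 - s/F) q e + c/s. *)
move: s0 F0; clear step IH err e0; move: c (norm2 (x0 - z) ^+ 2).
move: (sigma_min A ^+ 2) (normF A ^+ 2) => s F c e s0 F0.
move: (_ ^+ k) => q.
by field; rewrite !gt_eqF.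
Qed.

Theorem theorem4 (R : realType) (m n : nat)
    (At : 'M[R]_(m, n)) (bt : 'cV[R]_m) (x0 : 'cV[R]_n)
    (d : measure_display) (T : measurableType d) (P : probability T R)
    (idx : nat -> T -> 'I_m) :
  At != 0 ->
  rk_sampling P At idx ->
  forall (A : 'M[R]_(m, n)) (b : 'cV[R]_m),
  (exists x : 'cV[R]_n, A *m x = b) ->
  forall k : nat,
  let xLS := mppinv A *m b in
  let E : 'M[R]_(m, n) := At - A in
  let eps : 'cV[R]_m := bt - b in
  let sigma := sigma_min At in
  let Rt := normF At ^+ 2 / sigma ^+ 2 in
  let projr := orthproj (col_space At^T) in
  let projn := orthproj (null_space At) in
  ('E_P[fun w => (norm2 (rk_iter At bt x0 (fun j => idx j w) k
                        - projn x0 - projr xLS) ^+ 2)%R]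
   <= ((1 - 1 / Rt) ^+ k * norm2 (projr x0 - projr xLS) ^+ 2
       + norm2 (E *m xLS - eps) ^+ 2 / sigma ^+ 2)%R%:E)%E.
Proof.
move=> At0 smp A b [x Axb] k; lazy zeta.
set xLS := mppinv A *m b; set E := At - A; set eps := bt - b.
set projr := orthproj (col_space _); set projn := orthproj (null_space _).
pose z := projn x0 + projr xLS.
have AxLS : A *m xLS = b.
  by have [X1 _ _ _] := mppinvP A; rewrite /xLS -Axb !mulmxA X1.
have resE : bt - At *m z = - (E *m xLS - eps).
  rewrite mulmxDr mulmx_orthproj_row; have [-> _] := orthproj_null_spaceP At x0.
  by rewrite add0r /E /eps mulmxBl AxLS !opprB addrA subrK.
have e0E : x0 - z = projr x0 - projr xLS.
  by rewrite /z opprD addrA sub_orthproj_null.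
have e0 : col_space At^T (x0 - z).
  have [[y ye] _] := orthproj_col_spaceP At^T x0.
  have [[y' y'e] _] := orthproj_col_spaceP At^T xLS.
  by exists (y - y'); rewrite e0E mulmxBr -ye -y'e.
have -> : (fun w => norm2 (rk_iter At bt x0 (idx^~ w) k
                           - projn x0 - projr xLS) ^+ 2) =
          (fun w => norm2 (rk_iter At bt x0 (idx^~ w) k - z) ^+ 2).
  by apply/funext => w; rewrite -addrA -opprD.
have := rk_expected_sqr_error bt k At0 smp e0.
by rewrite resE norm2N e0E /rk_rate div1r invf_div.
Qed.
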